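(* Let $\lambda/\mu$ be an edgewise connected skew shape with $d$ diagonals. Then $\lambda/\mu$ has exactly $2^{d-1}$ outside decompositions.
   Context: Skew shapes. For partitions $\lambda=(\lambda_1\ge\dots\ge\lambda_k\ge 0)$, $\mu=(\mu_1\ge\dots\ge\mu_k\ge 0)$ with $\mu_i\le\lambda_i$ for all $i$, the skew diagram (skew shape) $\lambda/\mu$ is the set of boxes $(i,j)\in\mathbb{Z}^2$ with $1\le i\le k$, $\mu_i<j\le\lambda_i$; box $(i,j)$ lies in row $i$ from the top and column $j$ from the left. Two boxes are edgewise connected if they share a common edge; the diagram is edgewise connected if it is a (nonempty) connected set under this adjacency. The content of $(i,j)$ is $j-i$; a diagonal with content $c$ is the set of all boxes of $\lambda/\mu$ with content $c$ (only nonempty diagonals are counted). Border strips. A (border) strip is an edgewise connected skew diagram containing no $2\times2$ block of boxes. Its starting box is the box at its lower left end and its ending box is at its upper right end. Outside decompositions. A border strip decomposition of $\lambda/\mu$ is a partition of its boxes into pairwise disjoint strips (an unordered collection). It is an outside decomposition if every strip has its starting box on the left or bottom perimeter of $\lambda/\mu$ (its left or lower neighbour is not in $\lambda/\mu$) and its ending box on the right or top perimeter of $\lambda/\mu$ (its right or upper neighbour is not in $\lambda/\mu$). *)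

(* Defs.v *)
From mathcomp Require Import all_boot all_order all_algebra.
From mathcomp Require Import classical_sets functions cardinality.
Set Implicit Arguments.
Unset Strict Implicit.
Unset Printing Implicit Defensive.

Local Open Scope classical_set_scope.

(* A box (i, j) lies in row i (from the top) and column j (from the left).
   Rows and columns of diagrams are numbered from 1, so the index 0 is always
   outside: for a box (i, j) of a diagram, (i, j.-1) and (i.-1, j) really are
   its left and upper neighbours, boundary cases included. *)
Definition box := (nat * nat)%type.

Definition content (b : box) : int := (b.2%:Z - b.1%:Z)%R.

(* mu <= lam are partitions with the same number of (possibly zero) parts. *)
Definition skew_pair (lam mu : seq nat) : bool :=
  [&& sorted geq lam, sorted geq mu & all2 leq mu lam].

(* The part lam_i of the mathematical text is nth 0 lam i.-1. *)
Definition skew_diagram (lam mu : seq nat) : set box :=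
  [set b | (1 <= b.1 <= size lam) && (nth 0 mu b.1.-1 < b.2 <= nth 0 lam b.1.-1)].

Definition is_skew_diagram (S : set box) : Prop :=
  exists lam mu : seq nat, skew_pair lam mu /\ S = skew_diagram lam mu.

Definition adjacent (b c : box) : bool :=
  (b.1 == c.1) && ((b.2.+1 == c.2) || (c.2.+1 == b.2)) ||
  (b.2 == c.2) && ((b.1.+1 == c.1) || (c.1.+1 == b.1)).

Definition edgewise_connected (S : set box) : Prop :=
  S !=set0 /\
  forall b c, S b -> S c ->
    exists p : seq box,
      [/\ path adjacent b p, last b p = c & forall x, x \in p -> S x].

Definition diagonal (S : set box) (c : int) : set box :=
  [set b | S b /\ content b = c].

Definition diagonals (S : set box) : set (set box) :=
  [set X | X !=set0 /\ exists c : int, X = diagonal S c].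

Definition has_2x2_block (S : set box) : Prop :=
  exists i j : nat, [/\ S (i, j), S (i, j.+1), S (i.+1, j) & S (i.+1, j.+1)].

Definition border_strip (S : set box) : Prop :=
  [/\ is_skew_diagram S, edgewise_connected S & ~ has_2x2_block S].

(* Lower left end: the lowest row and the leftmost column of S at once. *)
Definition starting_box (S : set box) (b : box) : Prop :=
  S b /\ forall c, S c -> c.1 <= b.1 /\ b.2 <= c.2.

(* Upper right end: the highest row and the rightmost column of S at once. *)
Definition ending_box (S : set box) (b : box) : Prop :=
  S b /\ forall c, S c -> b.1 <= c.1 /\ c.2 <= b.2.

Definition left_bottom_perimeter (A : set box) (b : box) : Prop :=
  A b /\ (~ A (b.1, b.2.-1) \/ ~ A (b.1.+1, b.2)).

Definition right_top_perimeter (A : set box) (b : box) : Prop :=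
  A b /\ (~ A (b.1, b.2.+1) \/ ~ A (b.1.-1, b.2)).

Definition border_strip_decomposition (A : set box) (D : set (set box)) : Prop :=
  partition D id A /\ forall S, D S -> border_strip S.

Definition outside_decomposition (A : set box) (D : set (set box)) : Prop :=
  border_strip_decomposition A D /\
  forall S, D S ->
    (exists b, starting_box S b /\ left_bottom_perimeter A b) /\
    (exists b, ending_box S b /\ right_top_perimeter A b).

(* Main.v *)
Require Import Defs.
From mathcomp Require Import all_boot all_order all_algebra.
From mathcomp Require Import boolp classical_sets functions cardinality.
From mathcomp Require Import zify.

Set Implicit Arguments.
Unset Strict Implicit.
Unset Printing Implicit Defensive.

(** Fix a connected skew shape A.  An outside decomposition chooses, for each
    pair of consecutive diagonals, one of two directions (right or up): every
    box of the lower diagonal is then joined, inside its strip, to its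
    neighbour in that direction whenever this neighbour lies in A.  With d
    diagonals there are d - 1 independent choices, hence 2 ^ (d - 1)
    decompositions.

    _From decompositions to choices._  The boxes of A on two consecutive
    diagonals, listed from the upper left to the lower right, alternate
    between the two diagonals, and consecutive ones are neighbours: they form a
    zigzag, without gaps because A is convex for the product order
    ([skew_diagram_convex]).  A strip has at most one box on each diagonal
    ([strip_uniq]), so each box of the zigzag is joined to at most one of its
    two neighbours.  A box with both neighbours in A is joined to at least one
    of them, since otherwise it would be the start or the end of its strip
    while not lying on the required perimeter ([outside_joins_predecessor],
    [outside_joins_successor]).  Hence along the zigzag joined and separated
    pairs alternate, just as right steps and up steps do: whether a pair is
    joined exactly when it is a right step is constant on the two diagonals
    ([edge_direction_const]).

    _From choices to decompositions._  Given a direction f n for each n, join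
    every box of the n-th diagonal to its neighbour in direction f n, and take
    connected components.  All boxes of a component lie on one translate of a
    lattice path with steps f, because row + number of up steps below the
    diagonal is invariant ([reach_label]).  So rows weakly decrease and columns
    weakly increase along a component, which makes it a border strip
    ([reach_strip]); a component that could be continued at an end would be
    larger, so its ends are on the perimeter ([strips_outside]).

    _Bijectivity._  Strips being connected, a decomposition is determined by
    the pairs of adjacent boxes that it joins ([decomposition_eq]), so every
    outside decomposition comes from the choices read off from it
    ([outside_eq_strips]).  And A being connected, two adjacent boxes can be
    found on any two consecutive diagonals ([connected_step]), so distinct
    choices give distinct decompositions ([strips_inj]). *)

Local Open Scope classical_set_scope.
Local Open Scope card_scope.

(** * Skew diagrams are the finite order-convex sets of boxes *)

Definition order_convex (S : set box) : Prop :=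
  forall x y z, S x -> S y ->
    x.1 <= z.1 <= y.1 -> x.2 <= z.2 <= y.2 -> S z.

Definition fits (K N : nat) (S : set box) : Prop :=
  forall b, S b -> (1 <= b.1 <= K) && (1 <= b.2 <= N).

Lemma sorted_geq_nth (s : seq nat) i j :
  sorted geq s -> i <= j -> j < size s -> nth 0 s j <= nth 0 s i.
Proof.
move=> ss ij js.
have gt : transitive geq by move=> a b c /= ab bc; exact: leq_trans bc ab.
by apply: (sorted_leq_nth gt (fun n => leqnn n) 0 ss); rewrite ?inE //; lia.
Qed.

Lemma skew_diagram_convex lam mu :
  skew_pair lam mu -> order_convex (skew_diagram lam mu).
Proof.
case/and3P=> slam smu; rewrite all2E => /andP[/eqP szE _].
move=> [i j] [k l] [a b]; rewrite /skew_diagram /= => xS yS za zb.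
have := @sorted_geq_nth lam a.-1 k.-1 slam.
have := @sorted_geq_nth mu i.-1 a.-1 smu.
rewrite szE; lia.
Qed.

Lemma skew_diagram_fits lam mu :
  skew_pair lam mu -> fits (size lam) (nth 0 lam 0) (skew_diagram lam mu).
Proof.
case/and3P=> slam _ _ [i j]; rewrite /skew_diagram /= => xS.
have := @sorted_geq_nth lam 0 i.-1 slam; lia.
Qed.

(** The new part [l i] of the outer partition is the last column reached by S
    in row i or below, and [m i] is the last column, at most [l i], such that S
    has no box weakly above and to the left of (i, m i).  Taking extrema over
    all rows below or above, and not only over row i, makes both sequences
    monotone and gives empty rows consistent parts; a box between them lies
    between two boxes of S, hence in S by convexity. *)
Lemma convex_is_skew_diagram K N S :
  fits K N S -> order_convex S -> is_skew_diagram S.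
Proof.
move=> fS cS.
pose below i j := `[< exists2 x, S x & i <= x.1 /\ j <= x.2 >].
pose above i j := `[< exists2 x, S x & x.1 <= i /\ x.2 <= j >].
pose l i := \max_(j < N.+1 | below i j) j.
pose m i := \max_(j < N.+1 | (j <= l i) && ~~ above i j) j.
have leN i j : j <= N -> below i j -> j <= l i.
  move=> jN bj; have jN' : j < N.+1 by [].
  exact: (@leq_bigmax_cond _ (fun j : 'I_N.+1 => below i j)
            (fun j : 'I_N.+1 => j : nat) (Ordinal jN')).
have lP i j : 1 <= j -> j <= l i -> below i j.
  move=> j1 jl; apply/asboolP.
  have [[j0 bj0]|nob] := pselect (exists j0 : 'I_N.+1, below i j0).
    have [k /asboolP[x Sx [ix kx]] lk] :=
      @eq_bigmax_cond _ (fun j : 'I_N.+1 => below i j)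
        (fun j : 'I_N.+1 => j : nat) ltac:(by apply/card_gt0P; exists j0).
    exists x => //; split=> //; apply: leq_trans kx; apply: leq_trans jl _.
    by rewrite /l lk.
  move: jl; rewrite /l big1; first lia.
  by move=> k bk; case: nob; exists k.
have lN i : l i <= N by apply/bigmax_leqP => k _; rewrite -ltnS.
have ml i : m i <= l i by apply/bigmax_leqP => k /andP[].
have mP i j : j <= l i -> (j <= m i) || above i j.
  move=> jl; case: (boolP (above i j)) => [|na]; rewrite ?orbT // orbF.
  have jN : j < N.+1 by rewrite ltnS (leq_trans jl).
  apply: (@leq_bigmax_cond _ (fun j : 'I_N.+1 => (j <= l i) && ~~ above i j)
            (fun j : 'I_N.+1 => j : nat) (Ordinal jN)).
  by rewrite /= jl.
have mabove i j : above i j -> m i < j.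
  move=> /asboolP[x Sx [xi xj]].
  have j0 : 0 < j by have := fS _ Sx; lia.
  rewrite -(prednK j0) ltnS; apply/bigmax_leqP => k /andP[_ /asboolP nk].
  rewrite -ltnS (prednK j0) ltnNge; apply/negP => jk.
  by apply: nk; exists x => //; split=> //; apply: leq_trans jk.
have lmono i i' : i <= i' -> l i' <= l i.
  move=> ii; apply/bigmax_leqP => k /asboolP[x Sx [ix kx]].
  by apply: leN; [rewrite -ltnS | apply/asboolP; exists x => //; lia].
have mmono i i' : i <= i' -> m i' <= m i.
  move=> ii; case/orP: (mP i (minn (m i') (l i)) (geq_minr _ _)) => [|/asboolP].
    by have := ml i'; have := lmono _ _ ii; lia.
  case=> x Sx [xi xm].
  suff /mabove : above i' (m i') by lia.
  by apply/asboolP; exists x => //; lia.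
have sortG f k : (forall i i', i <= i' -> f i' <= f i) ->
    sorted geq (mkseq f k).
  move=> fm; apply/(sortedP 0) => i; rewrite size_mkseq => ik.
  rewrite !nth_mkseq; [exact: fm | lia..].
exists (mkseq (fun i => l i.+1) K), (mkseq (fun i => m i.+1) K); split.
  rewrite /skew_pair !sortG ?all2E ?size_mkseq ?eqxx /=; last 2 first.
  - by move=> i i' ii; apply: mmono.
  - by move=> i i' ii; apply: lmono.
  apply/(all_nthP (0, 0)) => i; rewrite size_zip !size_mkseq minnn => ik.
  by rewrite nth_zip ?size_mkseq //= !nth_mkseq.
apply/seteqP; split=> [[i j]|[i j]] /=.
  move=> Sx; have /= /andP[iK jN] := fS _ Sx.
  rewrite /skew_diagram /= size_mkseq iK /=.
  rewrite !nth_mkseq ?prednK; [|lia..].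
  rewrite mabove ?leN //; last 2 first.
  - by apply/asboolP; exists (i, j).
  - by apply/asboolP; exists (i, j).
  by case/andP: jN.
rewrite /skew_diagram /= size_mkseq => /andP[iK].
rewrite !nth_mkseq ?prednK; [|lia..] => /andP[mj jl].
have /asboolP[y Sy [iy jy]] := lP i j ltac:(lia) jl.
have /orP[|/asboolP[x Sx [xi xj]]] := mP i j jl; first lia.
by apply: (cS x y) => //=; lia.
Qed.

(** * Diagonals, steps and strips *)

(** The content j - i shifted by K, which keeps it a natural number on diagrams
    with at most K rows. *)
Definition diag (K : nat) (b : box) : nat := b.2 + K - b.1.

Definition follows (x y : box) : bool :=
  (y == (x.1, x.2.+1)) || (x == (y.1.+1, y.2)).

(** For a decomposition this is the equivalence relation whose classes are the
    strips. *)
Definition same_strip (D : set (set box)) (x y : box) : Prop :=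
  exists2 S, D S & S x /\ S y.

Lemma adjacentE x y : adjacent x y = follows x y || follows y x.
Proof. case: x y => [a b] [c d]; rewrite /adjacent /follows !xpair_eqE /=; lia. Qed.

Lemma followsP x y : reflect
  (y.1 = x.1 /\ y.2 = x.2.+1 \/ x.1 = y.1.+1 /\ x.2 = y.2) (follows x y).
Proof.
case: x y => [a b] [c d]; rewrite /follows !xpair_eqE /=; apply: (iffP idP); lia.
Qed.

Lemma diag_follows K x y : x.1 <= K -> follows x y -> diag K y = (diag K x).+1.
Proof. rewrite /diag => xK /followsP; lia. Qed.

Lemma box_ext (x y : box) : x.1 = y.1 -> x.2 = y.2 -> x = y.
Proof. by case: x y => [a b] [c d] /= -> ->. Qed.

(** Along a path the diagonal changes by one at each step, so a path from one
    side of the n-th diagonal to the other contains a step that leaves it. *)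
Lemma connected_step K S x y n :
  (forall b, S b -> b.1 <= K) -> edgewise_connected S -> S x -> S y ->
  diag K x <= n < diag K y ->
  exists u v, [/\ S u, S v, follows u v & diag K u = n].
Proof.
move=> SK [_ cS] Sx Sy; have [p [pp <- Sp]] := cS x y Sx Sy.
elim: p x Sx pp Sp {cS Sy y} => [|z p IH] x Sx /=; first lia.
move=> /andP[xz pp] Sp ran.
have Sz : S z by apply: Sp; rewrite inE eqxx.
have [nz|zn] := leqP (diag K z) n.
  by apply: (IH z Sz pp) => [w wp|]; [apply: Sp; rewrite inE wp orbT | lia].
move: xz; rewrite adjacentE => /orP[] f.
  have := diag_follows (SK _ Sx) f.
  by exists x, z; split=> //; lia.
have := diag_follows (SK _ Sz) f; lia.
Qed.

(** By convexity two boxes on one diagonal span a square of boxes, whose upper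
    left corner is a forbidden 2 x 2 block. *)
Lemma strip_uniq K S x y : (forall b, S b -> b.1 <= K) ->
  border_strip S -> S x -> S y -> diag K x = diag K y -> x = y.
Proof.
move=> SK [[lam [mu [sk SE]]] _ n2].
have cS : order_convex S by rewrite SE; exact: skew_diagram_convex.
suff ltS (u v : box) : S u -> S v -> diag K u = diag K v -> ~ u.1 < v.1.
  move=> Sx Sy dxy; have := ltS _ _ Sx Sy dxy; have := ltS _ _ Sy Sx (esym dxy).
  have := SK _ Sx; have := SK _ Sy; rewrite /diag in dxy *.
  by move=> *; apply: box_ext; lia.
move=> Su Sv duv luv; have uK := SK _ Su; have vK := SK _ Sv.
rewrite /diag in duv.
by case: n2; exists u.1, u.2; split; apply: (cS u v) => //=; lia.
Qed.

Lemma decomposition_sub A D S : border_strip_decomposition A D -> D S -> S `<=` A.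
Proof. by move=> [[<- _ _] _] DS x Sx; exists S. Qed.

Lemma decomposition_cover A D x :
  border_strip_decomposition A D -> A x -> exists2 S, D S & S x.
Proof. by move=> [[<- _ _] _] [S DS Sx]; exists S. Qed.

Lemma same_strip_mem A D S x y : border_strip_decomposition A D -> D S -> S x ->
  same_strip D x y -> S y.
Proof.
move=> [[_ tr _] _] DS Sx [S' DS' [S'x S'y]].
by rewrite (tr S S') //; exists x.
Qed.

Lemma same_strip_sym D x y : same_strip D x y -> same_strip D y x.
Proof. by case=> S DS [Sx Sy]; exists S. Qed.

Lemma same_strip_trans A D x y z : border_strip_decomposition A D ->
  same_strip D x y -> same_strip D y z -> same_strip D x z.
Proof.
move=> dec [S DS [Sx Sy]] yz; exists S => //; split=> //.
exact: same_strip_mem dec DS Sy yz.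
Qed.

Lemma same_strip_uniq K N A D x y : fits K N A -> border_strip_decomposition A D ->
  same_strip D x y -> diag K x = diag K y -> x = y.
Proof.
move=> fA dec [S DS [Sx Sy]]; apply: (strip_uniq (K := K) (S := S)) => //.
  by move=> b /(decomposition_sub dec DS)/fA; lia.
exact: (proj2 dec).
Qed.

(** * The direction chosen by an outside decomposition *)

(** If y is not the start of its strip, connectedness gives it a predecessor
    there, which is its left or its lower neighbour.  If it is, the perimeter
    condition contradicts that both neighbours are in A. *)
Lemma outside_joins_predecessor K N A D x y z : fits K N A -> outside_decomposition A D ->
  A y -> A x -> A z -> y = (x.1, x.2.+1) -> z = (y.1.+1, y.2) ->
  same_strip D x y \/ same_strip D z y.
Proof.
move=> fA [dec out] Ay Ax Az yE zE.
have [S DS Sy] := decomposition_cover dec Ay.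
have SK b : S b -> b.1 <= K by move=> /(decomposition_sub dec DS)/fA; lia.
have bs := proj2 dec _ DS.
have [[s [[Ss sP] [As per]]] _] := out S DS.
have := fA _ Ax; have := fA _ Ay => fy fx.
have [sy|ys] := ltnP (diag K s) (diag K y).
  have [|u [v [Su Sv fuv du]]] := @connected_step K S s y (diag K y).-1 SK
    (let: And3 _ c _ := bs in c) Ss Sy; first by lia.
  have dv := diag_follows (SK _ Su) fuv.
  have vE : v = y by apply: (strip_uniq SK bs) => //; lia.
  move: fuv; rewrite {}vE in Sv dv * => /followsP fuv.
  have [ux|uz] : u = x \/ u = z.
    case: fuv => fuv; [left|right]; apply: box_ext; move: fuv; rewrite ?zE yE /=; lia.
  - by left; exists S; rewrite -?ux.
  - by right; exists S; rewrite -?uz.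
have sE : s = y.
  have [] := sP _ Sy; have := fA _ As; rewrite /diag in ys * => *.
  by apply: box_ext; lia.
case: per; rewrite sE => /(_ _)[]; last by rewrite -zE.
by rewrite yE /= -surjective_pairing.
Qed.

(** The mirror image of the preceding lemma, at the ending box. *)
Lemma outside_joins_successor K N A D x y z : fits K N A -> outside_decomposition A D ->
  A x -> A y -> A z -> y = (x.1, x.2.+1) -> x = (z.1.+1, z.2) ->
  same_strip D x y \/ same_strip D x z.
Proof.
move=> fA [dec out] Ax Ay Az yE xE.
have [S DS Sx] := decomposition_cover dec Ax.
have SK b : S b -> b.1 <= K by move=> /(decomposition_sub dec DS)/fA; lia.
have bs := proj2 dec _ DS.
have [_ [s [[Ss sP] [As per]]]] := out S DS.
have := fA _ Ax; have := fA _ Ay => fy fx.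
have [sy|ys] := ltnP (diag K x) (diag K s).
  have [|u [v [Su Sv fuv du]]] := @connected_step K S x s (diag K x) SK
    (let: And3 _ c _ := bs in c) Sx Ss; first by lia.
  have uE : u = x by apply: (strip_uniq SK bs) => //; lia.
  move: fuv; rewrite uE => /followsP fuv.
  have [vy|vz] : v = y \/ v = z.
    by case: fuv => fuv; [left|right]; apply: box_ext; move: fuv;
      rewrite ?yE xE /=; lia.
  - by left; exists S; rewrite -?vy.
  - by right; exists S; rewrite -?vz.
have sE : s = x.
  have [] := sP _ Sx; have := fA _ As; rewrite /diag in ys * => *.
  by apply: box_ext; lia.
case: per; rewrite sE => /(_ _)[]; first by rewrite -yE.
by rewrite xE /= -surjective_pairing.
Qed.

(** The direction, [true] for right and [false] for up, that the pair (x, y)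
    reveals: that of the step from x to y if D joins x and y, and the other one
    if D separates them. *)
Definition edge_direction (D : set (set box)) (x y : box) : bool :=
  `[< same_strip D x y >] == (x.1 == y.1).

(** Induction along the zigzag formed by two consecutive diagonals.  The sum of
    the rows of x and y increases by exactly one from a step of the zigzag to
    the next one, which shares a box with it and has the other direction; the
    shared box is joined to exactly one of its two neighbours. *)
Lemma edge_direction_const K N A D x y x' y' :
  fits K N A -> order_convex A -> outside_decomposition A D ->
  A x -> A y -> follows x y -> A x' -> A y' -> follows x' y' ->
  diag K x = diag K x' -> edge_direction D x y = edge_direction D x' y'.
Proof.
move=> fA cA out; have dec := proj1 out.
wlog le : x y x' y' / x.1 + y.1 <= x'.1 + y'.1.
  move=> W Ax Ay f Ax' Ay' f' d.
  case/orP: (leq_total (x.1 + y.1) (x'.1 + y'.1)) => le.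
    exact: W.
  by apply/esym; apply: W.
have [n nE] : exists n, x'.1 + y'.1 = n + (x.1 + y.1).
  by exists (x'.1 + y'.1 - (x.1 + y.1)); lia.
move=> {le} + + + Ax' Ay' f'.
have fx' := fA _ Ax'; have fy' := fA _ Ay'.
have /followsP f'P := f'.
elim: n x y nE => [|n IH] x y nE Ax Ay f d.
  have fx := fA _ Ax; have fy := fA _ Ay.
  move/followsP: f => f; rewrite /diag in d.
  by congr edge_direction; apply: box_ext; lia.
have fx := fA _ Ax; have fy := fA _ Ay; have /followsP fP := f.
case: fP => [[yx1 yx2]|[xy1 xy2]].
- (* After the right step x -> y comes the up step into y, from z. *)
  pose z : box := (y.1.+1, y.2).
  have yE : y = (x.1, x.2.+1) by exact: box_ext.
  have Az : A z by rewrite /diag in d; apply: (cA x x') => //=; lia.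
  have zy : follows z y by apply/followsP; right.
  have dz : diag K z = diag K x' by rewrite /diag /= in d *; lia.
  rewrite -(IH z y) //; last by rewrite /=; lia.
  rewrite /edge_direction /= yx1 eqxx gtn_eqF //.
  case: asboolP => sxy; case: asboolP => szy //; exfalso.
    have := same_strip_trans dec sxy (same_strip_sym szy).
    move/(same_strip_uniq fA dec); rewrite dz d => /(_ erefl).
    by move/(congr1 fst) => /=; lia.
  by case: (@outside_joins_predecessor K N A D x y z).
- (* After the up step x -> y comes the right step out of x, to z. *)
  pose z : box := (x.1, x.2.+1).
  have xE : x = (y.1.+1, y.2) by exact: box_ext.
  have Az : A z by rewrite /diag in d; apply: (cA y y') => //=; lia.
  have xz : follows x z by apply/followsP; left.
  rewrite -(IH x z) //; last by rewrite /=; lia.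
  rewrite /edge_direction /= eqxx xy1 gtn_eqF //.
  case: asboolP => sxy; case: asboolP => sxz //; exfalso.
    have := same_strip_trans dec (same_strip_sym sxy) sxz.
    move/(same_strip_uniq fA dec).
    rewrite (@diag_follows K x y) ?(@diag_follows K x z) //; [|lia..] => /(_ erefl).
    by move/(congr1 fst) => /=; lia.
  by case: (@outside_joins_successor K N A D x z y).
Qed.

(** * A decomposition is determined by the adjacent pairs that it joins *)

(** Two boxes of a strip are linked by a path inside it, and each step of this
    path is an adjacent pair joined by D1. *)
Lemma same_strip_le A D1 D2 :
  border_strip_decomposition A D1 -> border_strip_decomposition A D2 ->
  (forall x y, A x -> A y -> follows x y ->
     same_strip D1 x y -> same_strip D2 x y) ->
  forall x y, same_strip D1 x y -> same_strip D2 x y.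
Proof.
move=> dec1 dec2 le x y [S DS [Sx Sy]].
have SA := decomposition_sub dec1 DS.
have [_ [_ /(_ x y Sx Sy)[p [pp <- Sp]]] _] := proj2 dec1 _ DS.
elim: p x Sx pp Sp {Sy} => [|z p IH] x Sx /=.
  have [S' D' S'x] := decomposition_cover dec2 (SA _ Sx).
  by exists S'.
move=> /andP[xz pp] Sp.
have Sz : S z by apply: Sp; rewrite inE eqxx.
apply: (same_strip_trans (y := z) dec2); last first.
  by apply: IH => // w wp; apply: Sp; rewrite inE wp orbT.
move: xz; rewrite adjacentE => /orP[] f.
  by apply: le => //; [exact: SA.. | exists S].
by apply: same_strip_sym; apply: le => //; [exact: SA.. | exists S].
Qed.

Lemma decomposition_eq A D1 D2 :
  border_strip_decomposition A D1 -> border_strip_decomposition A D2 ->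
  (forall x y, A x -> A y -> follows x y ->
     same_strip D1 x y <-> same_strip D2 x y) -> D1 = D2.
Proof.
suff sub D D' : border_strip_decomposition A D ->
    border_strip_decomposition A D' ->
    (forall x y, same_strip D x y <-> same_strip D' x y) -> D `<=` D'.
  move=> dec1 dec2 eqv.
  have ss x y : same_strip D1 x y <-> same_strip D2 x y.
    by split; apply: (@same_strip_le A) => // u v Au Av f; rewrite eqv.
  by apply/seteqP; split; apply: sub => // x y; rewrite ss.
move=> dec dec' ss S DS.
have [[_ _ /(_ S DS)[x Sx]] _] := dec.
have [S' DS' S'x] := decomposition_cover dec' (decomposition_sub dec DS Sx).
suff -> : S = S' by [].
apply/seteqP; split=> y Sy.
  by apply: (same_strip_mem dec' DS' S'x); apply/ss; exists S.
by apply: (same_strip_mem dec DS Sx); apply/ss; exists S'.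
Qed.

(** * The outside decomposition with given directions *)

Definition linked (K : nat) (f : nat -> bool) (x y : box) : bool :=
  (follows x y && ((x.1 == y.1) == f (diag K x))) ||
  (follows y x && ((y.1 == x.1) == f (diag K y))).

(** The connected component of x in the graph that [linked] induces on A. *)
Definition reach (A : set box) (K : nat) (f : nat -> bool) (x : box) : set box :=
  [set y | exists p, [/\ path (linked K f) x p, last x p = y
                      & forall z, z \in x :: p -> A z]].

Definition strips (A : set box) (K : nat) (f : nat -> bool) : set (set box) :=
  reach A K f @` A.

(** The rows climbed by the lattice path with directions f up to diagonal n. *)
Definition ups (f : nat -> bool) (n : nat) : nat := \sum_(k < n) ~~ f k.

Lemma linked_sym K f x y : linked K f x y = linked K f y x.
Proof. by rewrite /linked orbC. Qed.

Lemma linked_adjacent K f x y : linked K f x y -> adjacent x y.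
Proof. by rewrite adjacentE => /orP[]/andP[-> _]; rewrite ?orbT. Qed.

Lemma reach_refl A K f x : A x -> reach A K f x x.
Proof. by move=> Ax; exists [::]; split=> // z; rewrite inE => /eqP->. Qed.

Lemma reach_mem A K f x y : reach A K f x y -> A x /\ A y.
Proof.
case=> p [_ <- Ap]; split; apply: Ap; first exact: mem_head.
exact: mem_last.
Qed.

Lemma reach_trans A K f x y z : reach A K f x y -> reach A K f y z -> reach A K f x z.
Proof.
move=> [p [pp py Ap]] [q [qq qz Aq]]; exists (p ++ q).
rewrite cat_path last_cat py pp qq; split=> // w.
rewrite -cat_cons mem_cat => /orP[]; first exact: Ap.
by move=> wq; apply: Aq; rewrite inE wq orbT.
Qed.

Lemma reach_step A K f x y : A x -> A y -> linked K f x y -> reach A K f x y.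
Proof.
move=> Ax Ay l; exists [:: y]; rewrite /= l; split=> // z.
by rewrite !inE => /orP[]/eqP->.
Qed.

Lemma reach_sym A K f x y : reach A K f x y -> reach A K f y x.
Proof.
case=> p [+ <- +].
elim: p x => [|z p IH] x /=; first by move=> _ Ax; apply/reach_refl/Ax/mem_head.
move=> /andP[l pp] Ap.
have Az : A z by apply: Ap; rewrite !inE eqxx orbT.
apply: (reach_trans (y := z)).
  by apply: IH => // w wp; apply: Ap; rewrite inE wp orbT.
by apply: reach_step => //; [apply/Ap/mem_head | rewrite linked_sym].
Qed.

Lemma reach_eq A K f x y : reach A K f x y -> reach A K f x = reach A K f y.
Proof.
move=> xy; apply/seteqP; split=> z; last exact: reach_trans xy.
by apply: reach_trans; apply: reach_sym.
Qed.

Lemma upsS f n : ups f n.+1 = ups f n + ~~ f n.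
Proof. by rewrite /ups big_ord_recr. Qed.

(** A right step keeps the row and the number of up steps, an up step lowers the
    row index by one and increases the number of up steps by one.  This is what
    confines a component to a single translate of the lattice path, so that it
    meets each diagonal at most once. *)
Lemma reach_label A K N f x y : fits K N A -> reach A K f x y ->
  x.1 + ups f (diag K x) = y.1 + ups f (diag K y).
Proof.
move=> fA [p [+ <- +]].
have step u v : A u -> A v -> follows u v ->
    (u.1 == v.1) == f (diag K u) ->
    u.1 + ups f (diag K u) = v.1 + ups f (diag K v).
  move=> Au Av fuv /eqP fE; have fu := fA _ Au.
  rewrite (@diag_follows K u v) ?upsS -?fE //; last by lia.
  move/followsP: fuv; lia.
elim: p x => [|z p IH] x //= /andP[l pp] Ap.
have Az : A z by apply: Ap; rewrite !inE eqxx orbT.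
have Ax : A x by apply/Ap/mem_head.
rewrite -IH //; last by move=> w wp; apply: Ap; rewrite inE wp orbT.
by case/orP: l => /andP[l e]; [apply: step | apply/esym/step].
Qed.

Lemma reach_connected A K f x : A x -> edgewise_connected (reach A K f x).
Proof.
move=> Ax; split; first by exists x; exact: reach_refl.
move=> b c xb xc; have bc := reach_trans (reach_sym xb) xc.
have [p [pp pc Ap]] := bc; exists p; split=> //.
  by apply: sub_path pp => u v; exact: linked_adjacent.
move=> z zp; apply: (reach_trans xb).
case/splitPr: zp pp Ap => p1 p2; rewrite -cat_rcons cat_path => /andP[pp _] Ap.
exists (rcons p1 z); rewrite last_rcons; split=> // w.
by rewrite inE => wp; apply: Ap; rewrite inE mem_cat orbA wp.
Qed.

Lemma ups_le f m n : m <= n -> ups f m <= ups f n <= ups f m + (n - m).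
Proof.
move=> /subnKC <-; rewrite addKn.
elim: (n - m) => [|k IH]; first by rewrite !addn0 leqnn.
by rewrite addnS upsS; lia.
Qed.

Lemma reach_monotone A K N f x y : fits K N A -> reach A K f x y ->
  diag K x <= diag K y -> y.1 <= x.1 /\ x.2 <= y.2.
Proof.
move=> fA xy dxy; have lab := reach_label fA xy.
have [Ax Ay] := reach_mem xy.
have := fA _ Ax; have := fA _ Ay; have := ups_le f dxy.
rewrite /diag in dxy lab *; lia.
Qed.

(** A component is monotone from its lower left to its upper right end.  Hence
    two of its boxes that are comparable in the product order share a row or a
    column, which gives convexity, and a 2 x 2 block is impossible. *)
Lemma reach_strip A K N f x : fits K N A -> A x -> border_strip (reach A K f x).
Proof.
move=> fA Ax.
have RA y : reach A K f x y -> A y by move=> xy; case: (reach_mem xy).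
have RR u v : reach A K f x u -> reach A K f x v -> reach A K f u v.
  by move=> xu; apply: reach_trans; apply: reach_sym.
have fR : fits K N (reach A K f x) by move=> b /RA/fA.
split; last 2 first.
- exact: reach_connected.
- move=> [i [j [a _ _ b]]]; have := fR _ a; have := fR _ b => /= fb fa.
  have [] := reach_monotone fA (RR _ _ a b); rewrite /diag /=; lia.
apply: (convex_is_skew_diagram fR) => // u v z xu xv zr zc.
have fu := fR _ xu; have fv := fR _ xv.
(* Between two boxes of one row or one column, z is the only position on its
   diagonal that monotonicity allows, and the component meets that diagonal. *)
have onto a b : reach A K f x a -> reach A K f x b ->
    diag K a <= diag K z <= diag K b -> a.1 = b.1 \/ a.2 = b.2 ->
    b.1 <= z.1 <= a.1 -> a.2 <= z.2 <= b.2 -> reach A K f x z.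
  move=> xa xb dz line rz cz.
  have [w [xw dw]] : exists w, reach A K f x w /\ diag K w = diag K z.
    have [zb|bz] := ltnP (diag K z) (diag K b); last by exists b; split=> //; lia.
    have [||w [? [? ? _ ?]]] :=
      @connected_step K _ a b (diag K z) _ (reach_connected K f Ax) xa xb.
    - by move=> c /fR; lia.
    - by lia.
    by exists w.
  have fw := fR _ xw; have fa := fR _ xa; have fb := fR _ xb.
  have [] := reach_monotone fA (RR _ _ xa xw); first by lia.
  have [] := reach_monotone fA (RR _ _ xw xb); first by lia.
  move=> *; suff <- : w = z by [].
  by rewrite /diag in dw dz; apply: box_ext; lia.
have [uv|vu] := leqP (diag K u) (diag K v).
  have [] := reach_monotone fA (RR _ _ xu xv) uv.
  by move=> *; apply: (onto u v) => //; rewrite /diag; lia.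
have [] := reach_monotone fA (RR _ _ xv xu) (ltnW vu).
by move=> *; apply: (onto v u) => //; rewrite /diag; lia.
Qed.

Lemma strips_decomposition A K N f : fits K N A ->
  border_strip_decomposition A (strips A K f).
Proof.
move=> fA; split; last by move=> _ [x Ax <-]; exact: (reach_strip _ fA).
split.
- apply/seteqP; split=> [y [_ [x Ax <-]] /= xy|x Ax]; first by case: (reach_mem xy).
  by exists (reach A K f x); [exists x | exact: reach_refl].
- move=> _ _ [x Ax <-] [y Ay <-] [z [/= xz yz]].
  by rewrite (reach_eq xz) (reach_eq yz).
- by move=> _ [x Ax <-]; exists x; exact: reach_refl.
Qed.

(** Direct if the step follows f; otherwise the step violates the invariance of
    [reach_label], so x and y are in different components. *)
Lemma strips_same A K N f x y : fits K N A -> A x -> A y -> follows x y ->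
  same_strip (strips A K f) x y <-> f (diag K x) = (x.1 == y.1).
Proof.
move=> fA Ax Ay fxy; split.
  case=> _ [z Az <-] [zx zy].
  have := reach_label fA (reach_trans (reach_sym zx) zy).
  have fx := fA _ Ax.
  rewrite (diag_follows _ fxy) ?upsS; last by lia.
  by move/followsP: fxy; case: (f _); lia.
move=> fE; exists (reach A K f x); first by exists x.
split; first exact: reach_refl.
by apply: reach_step => //; rewrite /linked fxy fE eqxx.
Qed.

(** The box of a component on its lowest diagonal is its start.  If the
    neighbour preceding it in the direction of f were in A, it would belong to
    the component too, and lie on a lower diagonal; so this left or lower
    neighbour is outside A.  The end is treated likewise. *)
Lemma strips_outside A K N f : fits K N A ->
  outside_decomposition A (strips A K f).
Proof.
move=> fA; split; first exact: strips_decomposition fA.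
move=> _ [x Ax <-].
have RA y : reach A K f x y -> A y by move=> xy; case: (reach_mem xy).
have RR u v : reach A K f x u -> reach A K f x v -> reach A K f u v.
  by move=> xu; apply: reach_trans; apply: reach_sym.
pose occ n := `[< exists2 y, reach A K f x y & diag K y = n >].
have exo : exists n, occ n.
  by exists (diag K x); apply/asboolP; exists x => //; exact: reach_refl.
have ubo n : occ n -> n <= K + N.
  by move=> /asboolP[y /RA/fA fy <-]; rewrite /diag; lia.
split.
  have [n /asboolP[s xs <-] mins] := ex_minnP exo.
  have As := RA _ xs; have fs := fA _ As.
  have smin c : reach A K f x c -> diag K s <= diag K c.
    by move=> xc; apply: mins; apply/asboolP; exists c.
  exists s; split; first split=> // c xc.
    exact: (reach_monotone fA (RR _ _ xs xc) (smin _ xc)).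
  split=> //.
  have stuck u : A u -> follows u s -> (u.1 == s.1) <> f (diag K u).
    move=> Au us e; have fu := fA _ Au.
    have /smin : reach A K f x u.
      apply: reach_trans xs _; apply: reach_step => //.
      by rewrite linked_sym /linked us e eqxx.
    by rewrite (diag_follows _ us); lia.
  case fE: (f (diag K s).-1); [left|right] => Au.
    apply: (stuck _ Au); first by apply/followsP; left; rewrite /=; lia.
    by rewrite /= eqxx -[LHS]fE; congr f; rewrite /diag /=; have := fA _ Au => /=; lia.
  apply: (stuck _ Au); first by apply/followsP; right.
  rewrite /= gtn_eqF // -[LHS]fE; congr f.
  by rewrite /diag /=; have := fA _ Au => /=; lia.
have [n /asboolP[s xs <-] maxs] := ex_maxnP exo ubo.
have As := RA _ xs; have fs := fA _ As.
have smax c : reach A K f x c -> diag K c <= diag K s.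
  by move=> xc; apply: maxs; apply/asboolP; exists c.
exists s; split; first split=> // c xc.
  by case: (reach_monotone fA (RR _ _ xc xs) (smax _ xc)).
split=> //.
have stuck u : A u -> follows s u -> (s.1 == u.1) <> f (diag K s).
  move=> Au su e.
  have /smax : reach A K f x u.
    apply: reach_trans xs _; apply: reach_step => //.
    by rewrite /linked su e eqxx.
  by rewrite (diag_follows _ su); lia.
case fE: (f (diag K s)); [left|right] => Au; apply: (stuck _ Au).
- by apply/followsP; left.
- by rewrite /= eqxx fE.
- by apply/followsP; right; have := fA _ Au => /=; lia.
- by rewrite fE /=; have := fA _ Au => /=; lia.
Qed.

(** * Counting *)

(** By connectedness the nonempty diagonals form an interval. *)
Lemma diag_range A K N : fits K N A -> edgewise_connected A ->
  exists m e, m <= e /\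
    forall n, m <= n <= e <-> exists2 b, A b & diag K b = n.
Proof.
move=> fA cA; pose occ n := `[< exists2 y, A y & diag K y = n >].
have exo : exists n, occ n.
  by have [[x Ax] _] := cA; exists (diag K x); apply/asboolP; exists x.
have ubo n : occ n -> n <= K + N.
  by move=> /asboolP[y /fA fy <-]; rewrite /diag; lia.
have [m om mins] := ex_minnP exo; have [e oe maxs] := ex_maxnP exo ubo.
exists m, e; split; first exact: maxs.
move=> n; split=> [mne|[b Ab <-]]; last first.
  by apply/andP; split; [apply: mins | apply: maxs]; apply/asboolP; exists b.
have [/asboolP[x Ax xm] /asboolP[y Ay ye]] := (om, oe).
have [ne|en] := ltnP n e; last by exists y => //; lia.
have [||u [_ [Au _ _ du]]] := @connected_step K A x y n _ cA Ax Ay.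
- by move=> b /fA; lia.
- by lia.
by exists u.
Qed.

Lemma diagonals_card A K N m e : fits K N A ->
  (forall n, m <= n <= e <-> exists2 b, A b & diag K b = n) -> m <= e ->
  diagonals A #= `I_(e - m).+1.
Proof.
move=> fA range me.
pose g i := [set b | A b /\ diag K b = m + i].
have gocc i : i < (e - m).+1 -> exists2 b, A b & diag K b = m + i.
  by move=> ie; apply/range; lia.
have -> : diagonals A = g @` `I_(e - m).+1.
  apply/seteqP; split=> [X [[b Xb] [c XE]]|X [i /= ie <-]].
    move: Xb; rewrite {}XE => -[Ab bc].
    have bme : m <= diag K b <= e by apply/range; exists b.
    exists (diag K b - m) => /=; first by lia.
    have fb := fA _ Ab; rewrite /g subnKC; last by lia.
    apply/seteqP; split=> x [Ax dx]; split=> //; have fx := fA _ Ax;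
      by rewrite /content /diag in bc dx bme *; lia.
  have [b Ab db] := gocc i ie; split; first by exists b.
  exists (content b); have fb := fA _ Ab.
  apply/seteqP; split=> x [Ax dx]; split=> //; have fx := fA _ Ax;
    by rewrite /content /diag in db dx *; lia.
apply: inj_card_eq => i j; rewrite !inE /= => ie je gij.
have [b Ab db] := gocc i ie.
have : g j b by rewrite -gij.
by case=> _; lia.
Qed.

(** On each diagonal f takes the common value of [edge_direction], and
    with this choice the same adjacent pairs are joined on both sides. *)
Lemma outside_eq_strips A K N D : fits K N A -> order_convex A ->
  outside_decomposition A D -> exists f, D = strips A K f.
Proof.
move=> fA cA out.
exists (fun n => `[< exists x y, [/\ A x, A y, follows x y, diag K x = n
                               & edge_direction D x y] >]).
apply: (decomposition_eq (proj1 out) (strips_decomposition _ fA)).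
move=> x y Ax Ay fxy; rewrite (strips_same _ fA) //.
have -> : `[< exists x0 y0, [/\ A x0, A y0, follows x0 y0, diag K x0 = diag K x
                            & edge_direction D x0 y0] >] = edge_direction D x y.
  apply/asboolP/idP => [[x' [y' [Ax' Ay' f' d' fl]]]|fl]; last by exists x, y.
  by rewrite (edge_direction_const fA cA out Ax Ay fxy Ax' Ay' f').
rewrite /edge_direction; split=> [/asboolP -> //|].
by case: asboolP => // _; case: (x.1 == y.1).
Qed.

Lemma eq_strips A K N m e f g : fits K N A ->
  (forall n, m <= n <= e <-> exists2 b, A b & diag K b = n) ->
  (forall n, m <= n < e -> f n = g n) -> strips A K f = strips A K g.
Proof.
move=> fA range fg.
apply: (decomposition_eq (strips_decomposition _ fA) (strips_decomposition _ fA)).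
move=> x y Ax Ay fxy; rewrite !(strips_same _ fA) // fg //.
have : m <= diag K x <= e by apply/range; exists x.
have : m <= diag K y <= e by apply/range; exists y.
by rewrite (diag_follows _ fxy); have := fA _ Ax; lia.
Qed.

Lemma strips_inj A K N m e f g : fits K N A -> edgewise_connected A ->
  (forall n, m <= n <= e <-> exists2 b, A b & diag K b = n) ->
  strips A K f = strips A K g -> forall n, m <= n < e -> f n = g n.
Proof.
move=> fA cA range fg n mn.
have [x Ax dx] : exists2 b, A b & diag K b = m by apply/range; lia.
have [y Ay dy] : exists2 b, A b & diag K b = e by apply/range; lia.
have [||u [v [Au Av fuv <-]]] := @connected_step K A x y n _ cA Ax Ay.
- by move=> b /fA; lia.
- by lia.
have : (f (diag K u) == (u.1 == v.1)) = (g (diag K u) == (u.1 == v.1)).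
  by apply/eqP/eqP; rewrite -!(strips_same _ fA) // fg.
by case: (f _) (g _) (u.1 == v.1) => [] [] [].
Qed.

Theorem corollary2p3 (lam mu : seq nat) (d : nat)
    (hskew : skew_pair lam mu)
    (hconn : edgewise_connected (skew_diagram lam mu))
    (hd : diagonals (skew_diagram lam mu) #= `I_d) :
  [set D | outside_decomposition (skew_diagram lam mu) D] #= `I_(2 ^ (d - 1)).
Proof.
set A := skew_diagram lam mu in hconn hd *.
have fA := skew_diagram_fits hskew.
have cA := skew_diagram_convex hskew.
have [m [e [me range]]] := diag_range fA hconn.
have dE : d = (e - m).+1.
  apply/card_eq_II; apply: card_eq_trans (diagonals_card fA range me).
  by rewrite card_eq_sym.
rewrite {}dE subn1 /= {hd}.
(* The diagonals from which a step can start are m, ..., e - 1, so directions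
   are recorded by functions on 'I_(e - m), extended by false elsewhere. *)
pose ext (c : {ffun 'I_(e - m) -> bool}) n :=
  if insub (n - m) is Some i then c i else false.
pose Phi c := strips A (size lam) (ext c).
have extE c (i : 'I_(e - m)) : ext c (m + i) = c i.
  by rewrite /ext addKn valK.
have -> : [set D | outside_decomposition A D] = Phi @` setT.
  apply/seteqP; split=> [D /= out|_ [c _ <-]]; last exact: strips_outside fA.
  have [f ->] := outside_eq_strips fA cA out.
  exists [ffun i : 'I_(e - m) => f (m + i)] => //.
  apply: (eq_strips fA range) => n mn.
  have ne : n - m < e - m by lia.
  by rewrite -[n](@subnKC m) ?(extE _ (Ordinal ne)) ?ffunE //; lia.
have Phi_inj : {in [set: {ffun 'I_(e - m) -> bool}] &, injective Phi}.
  move=> c c' _ _ eq; apply/ffunP => i; rewrite -!extE.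
  by apply: (strips_inj fA hconn range eq); have := ltn_ord i; lia.
apply: card_eq_trans (inj_card_eq Phi_inj) _.
have -> : 2 ^ (e - m) = #|{ffun 'I_(e - m) -> bool}|.
  by rewrite card_ffun card_bool card_ord.
rewrite card_eq_sym.
apply: card_eq_trans card_II _.
have -> : [set: {ffun 'I_(e - m) -> bool}] =
    enum_val @` [set: 'I_#|{ffun 'I_(e - m) -> bool}|].
  apply/seteqP; split=> // c _; exists (enum_rank c) => //.
  by rewrite enum_rankK.
rewrite card_eq_sym; apply: inj_card_eq => i j _ _; exact: enum_val_inj.
Qed.
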